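(* Let $\ell\ge0$ be an integer and $q$ a prime power, both fixed, and set $a=k-\ell$, $b=2n-k-\ell$ (so $a,b\ge0$ and $a+b+2\ell=2n$), where $a$ and $b$ are even. (1) (Boundary regime: $k$ fixed, $n\to\infty$.) Fix $a\ge2$ and let $b\to\infty$. Then $$\frac{A^S_{2n,k,\ell,q}}{A^S_{2n,k,\ell+2,q}}\longrightarrow\frac{q^{a-2}(q^{\ell+1}-1)(q^{\ell+2}-1)}{q^a-1}.$$ (2) (Joint regime: $k\to\infty$ and $2n-k\to\infty$.) Let $a,b\to\infty$ simultaneously. Then $$\frac{A^S_{2n,k,\ell,q}}{A^S_{2n,k,\ell+2,q}}\longrightarrow\frac{(q^{\ell+1}-1)(q^{\ell+2}-1)}{q^2}.$$ (3) The asymptotic ratio in (2) is minimized at $\ell=0$, where it equals $(q-1)(q^2-1)/q^2$. At $q=2$ this equals $3/4<1$: the joint limit $a,b\to\infty$ at $\ell=0$, $q=2$ is taken within the exception family $\mathcal{E}_S=\{(2n,k,0,2):4\le k\le 2n-4,\ k\text{ even}\}$, and indeed $\mathcal{E}_S$ contains arbitrarily large parameters, so the asymptotic value $3/4<1$ confirms that the inequality $$A^S_{2n,k,\ell,q}>(q^{\ell+1}-1)(q^{\ell+2}-1)\,A^S_{2n,k,\ell+2,q}$$ (the BBO inequality) fails throughout $\mathcal{E}_S$ as $2n$ grows. For $q\ge3$, the asymptotic ratio at $\ell=0$ is $(q-1)^2(q+1)/q^2\ge 16/9>1$, lying outside the exception family. For each fixed $\ell\ge1$ the asymptotic ratio is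 strictly larger than at $\ell=0$ (for example, $A^S_{2n,k,1,q}/A^S_{2n,k,3,q}\to21/4$ at $q=2$ in the joint regime), and monotonicity (that is, $A^S_{2n,k,\ell,q}>A^S_{2n,k,\ell+2,q}$) holds asymptotically in all cases with $\ell\ge1$.
   Context: For a prime power $q$, the symplectic inner product on $\mathbb{F}_q^{2n}$ is $\langle\mathbf{x},\mathbf{y}\rangle_S=\sum_{i=1}^n(x_iy_{n+i}-x_{n+i}y_i)$. For a linear subspace $C\subseteq\mathbb{F}_q^{2n}$, its symplectic dual is $C^{\perp_S}=\{\mathbf{y}\in\mathbb{F}_q^{2n}:\langle\mathbf{x},\mathbf{y}\rangle_S=0\ \forall\mathbf{x}\in C\}$ and its symplectic hull is $\mathrm{Hull}_S(C)=C\cap C^{\perp_S}$. The number $A^S_{2n,k,\ell,q}$ is the number of $k$-dimensional subspaces $C\subseteq\mathbb{F}_q^{2n}$ with $\dim\mathrm{Hull}_S(C)=\ell$. ''BBO'' refers to Bouyuklieva, Bouyukliev and Özbudak, who studied the analogous inequality for Euclidean hulls. *)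

(* Defs.v *)
From HB Require Import structures.
From mathcomp Require Import all_boot all_order all_algebra.
From mathcomp Require Import all_classical all_reals all_analysis.

Set Implicit Arguments.
Unset Strict Implicit.
Unset Printing Implicit Defensive.

Import Order.TTheory GRing.Theory Num.Theory.
Import numFieldNormedType.Exports.

Local Open Scope classical_set_scope.
Local Open Scope ring_scope.

(* The vector library gives {vspace _} no finType structure; counting
   subspaces needs one. *)
Import VectorInternalTheory.
HB.instance Definition _ (F : finFieldType) (vT : vectType F) :=
  [Countable of {vspace vT} by <:].
HB.instance Definition _ (F : finFieldType) (vT : vectType F) :=
  [Finite of {vspace vT} by <:].

Section Symplectic.
Variables (F : finFieldType) (n : nat).
Implicit Types (x y : 'rV[F]_(n + n)) (C : {vspace 'rV[F]_(n + n)}).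

Definition sympl x y : F :=
  \sum_(i < n) (x 0 (lshift n i) * y 0 (rshift n i)
                - x 0 (rshift n i) * y 0 (lshift n i)).

(* The spanning set is already a subspace, see [sdualP]; the span only
   repackages it as a {vspace _}. *)
Definition sdual C : {vspace 'rV[F]_(n + n)} :=
  <<enum [pred y : 'rV[F]_(n + n) |
            [forall (x : 'rV[F]_(n + n) | x \in C), sympl x y == 0%R]]>>%VS.

Definition shull C : {vspace 'rV[F]_(n + n)} := (C :&: sdual C)%VS.

Lemma symplDr x : {morph sympl x : y z / y + z}.
Proof.
move=> y z; rewrite /sympl -big_split /=; apply: eq_bigr => i _.
by rewrite !mxE !mulrDr opprD addrACA.
Qed.

Lemma symplZr x a y : sympl x (a *: y) = a * sympl x y.
Proof.
rewrite /sympl mulr_sumr; apply: eq_bigr => i _.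
by rewrite !mxE mulrBr; congr (_ - _); rewrite mulrCA.
Qed.

Lemma sympl0r x : sympl x 0 = 0.
Proof. by rewrite -(scale0r 0) symplZr mul0r. Qed.

Lemma sdualP C y :
  reflect (forall x, x \in C -> sympl x y = 0) (y \in sdual C).
Proof.
apply: (iffP idP) => [yC x xC|Hy].
  move/coord_span: yC => ->.
  elim/big_ind: _ => [|u v Hu Hv|i _].
  - exact: sympl0r.
  - by rewrite symplDr Hu Hv addr0.
  - rewrite symplZr -tnth_nth.
    have := mem_tnth i (enum_tuple _); rewrite mem_enum inE.
    by move=> /forall_inP/(_ x xC)/eqP ->; rewrite mulr0.
apply: memv_span; rewrite mem_enum inE; apply/forall_inP => x xC.
by rewrite Hy.
Qed.

End Symplectic.

(* $A^S_{2n,k,\ell,q}$, for F the field with q elements *)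
Definition AS (F : finFieldType) (n k l : nat) : nat :=
  #|[pred C : {vspace 'rV[F]_(n + n)}
      | (\dim C == k) && (\dim (shull C) == l)]|.

Definition ratioS (R : realType) (F : finFieldType) (n k l : nat) : R :=
  (AS F n k l)%:R / (AS F n k l.+2)%:R.

(* a = k - l and b = 2n - k - l determine k and n; the halving is exact
   whenever a and b are even. *)
Definition k_of (l a : nat) : nat := (a + l)%N.
Definition n_of (l a b : nat) : nat := ((a + b + 2 * l)./2)%N.

Definition ratioS_ab (R : realType) (F : finFieldType) (l a b : nat) : R :=
  ratioS R F (n_of l a b) (k_of l a) l.

(* m tends to infinity through the even integers *)
Definition even_oo : set_system nat := within [set m | ~~ odd m] \oo.

Global Instance even_oo_filter : ProperFilter even_oo.
Proof.
apply: Build_ProperFilter => -[N _ HN].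
by apply: (HN N.*2); rewrite /= ?odd_double// -addnn leq_addr.
Qed.

(* a and b tend to infinity simultaneously and independently *)
Definition joint : set_system (nat * nat) := filter_prod even_oo even_oo.

Definition joint_ratio (R : realType) (F : finFieldType) (l : nat) : R :=
  lim ((fun p : nat * nat => ratioS_ab R F l p.1 p.2) @ joint).

(* quadruples (2n, k, l, q) *)
Definition exc_S : set (nat * nat * nat * nat) :=
  [set p | exists n k : nat,
     [/\ p = (2 * n, k, 0, 2)%N, (4 <= k <= 2 * n - 4)%N & ~~ odd k]].

Definition BBO (F : finFieldType) (n k l : nat) : bool :=
  ((#|F| ^ l.+1 - 1) * (#|F| ^ l.+2 - 1) * AS F n k l.+2 < AS F n k l)%N.

Definition hull_mono (F : finFieldType) (n k l : nat) : bool :=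
  (AS F n k l.+2 < AS F n k l)%N.

(* Main.v *)
From HB Require Import structures.
Require Import Defs.
From mathcomp Require Import all_boot all_order all_algebra.
From mathcomp Require Import finfield zify ring lra.
From mathcomp Require Import all_classical all_reals all_analysis.

(** Everything follows from one exact identity.  With [q = #|F|], [a = k - l]
    and [b = 2n - k - l], where [a >= 2] and [b >= 1],
      [AS k l * ((q^a - 1) * (q^b - 1))
         = AS k l.+2 * (q^(a+b-2) * ((q^l.+1 - 1) * (q^l.+2 - 1)))]
    ([AS_hull_step]).  Both limits, the failure of the BBO inequality and
    the monotonicity for [l >= 1] are elementary consequences, since the ratio
    is [(q^l.+1 - 1) * (q^l.+2 - 1) / q^2] times a factor
    [q^m / (q^m - 1)], tending to 1, for each of [m = a] and [m = b].

    The identity avoids counting isotropic or nondegenerate subspaces.  It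
    compares dimension [k] with dimension [k - 1] by double counting flags
    [E < C] with [\dim C = \dim E + 1].  If [E] has hull [H] and [v] is not
    in [E], the hull of [E + <[v]>] has dimension [\dim H + 1] when [v] is
    orthogonal to [H] and [\dim H - 1] otherwise ([dim_shull_up],
    [dim_shull_down]), so the number of covers of [E] with a given hull
    dimension depends only on the dimensions of [E] and [H].  Counting the
    hyperplanes of [C] needs no further argument: [C] and its dual have the
    same hull, and duality turns hyperplanes of [C] into covers of its dual
    ([num_flags_sdual]).  Equating the two counts gives one recurrence for
    flags along which the hull grows ([AS_up]) and one for flags along which
    it shrinks ([AS_down]); both pass through [AS (k - 1) l.+1], and their
    combination is the identity.  The same recurrences, started at the zero
    subspace, show that the denominators of the ratios do not vanish
    ([AS_gt0]). *)

Set Implicit Arguments.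
Unset Strict Implicit.
Unset Printing Implicit Defensive.

Import Order.TTheory GRing.Theory Num.Theory.
Import numFieldNormedType.Exports.

Local Open Scope classical_set_scope.
Local Open Scope ring_scope.

(** * Symplectic duality *)

Ltac dim_lia := unfold reverse_coercion in *; lia.

Section SymplecticDuality.
Variables (F : finFieldType) (n : nat).
Local Notation V := 'rV[F]_(n + n).
Implicit Types (x y v : V) (C D E : {vspace V}).

Lemma sympl_alternating x : sympl x x = 0.
Proof. by rewrite /sympl big1 // => i _; rewrite mulrC subrr. Qed.

Lemma sympl_antisym x y : sympl y x = - sympl x y.
Proof. by rewrite /sympl -sumrN; apply: eq_bigr => i _; ring. Qed.

Lemma sympl_nondegenerate y : (forall x, sympl x y = 0) -> y = 0.
Proof.
move=> y0; apply/rowP => j; rewrite mxE -(fintype.splitK j).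
case: (fintype.split j) => i /=.
- have := y0 (delta_mx 0 (rshift n i)).
  rewrite /sympl (bigD1 i) //= big1 => [|k kNi]; rewrite !mxE !eqxx /=.
    rewrite eq_lrshift mul0r mul1r addr0 sub0r => /eqP.
    by rewrite oppr_eq0 => /eqP.
  by rewrite eq_lrshift eq_rshift (negPf kNi) !mul0r subrr.
- have := y0 (delta_mx 0 (lshift n i)).
  rewrite /sympl (bigD1 i) //= big1 => [|k kNi]; rewrite !mxE !eqxx /=.
    by rewrite eq_rlshift mul0r mul1r addr0 subr0.
  by rewrite eq_rlshift eq_lshift (negPf kNi) !mul0r subrr.
Qed.

(** The pairings of [y] with a basis of [C], gathered into one linear map:
    its kernel is the dual of [C]. *)
Definition sympl_row k (b : k.-tuple V) y : 'rV[F]_k := \row_i sympl b`_i y.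

Lemma sympl_row_linear k (b : k.-tuple V) : linear (sympl_row b).
Proof. by move=> a y z; apply/rowP => i; rewrite !mxE symplDr symplZr. Qed.

HB.instance Definition _ k (b : k.-tuple V) :=
  GRing.isLinear.Build F V 'rV[F]_k *:%R (sympl_row b) (sympl_row_linear b).

Lemma dim_full_space : \dim {:V} = (n + n)%N.
Proof. by rewrite dimvf /dim /= mul1n. Qed.

Lemma dim_le_full C : (\dim C <= n + n)%N.
Proof. by rewrite -[leqRHS]dim_full_space dimvS ?subvf. Qed.

(** The dual is cut out by [\dim C] linear equations. *)
Lemma dim_sdual_ge C : (n + n <= \dim (sdual C) + \dim C)%N.
Proof.
pose f : 'Hom(V, 'rV[F]_(\dim C)) := linfun (sympl_row (vbasis C)).
have kerC : (lker f <= sdual C)%VS.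
  apply/subvP => y; rewrite memv_ker lfunE /= => /eqP/rowP fy0.
  apply/sdualP => x /coord_vbasis ->; rewrite sympl_antisym.
  apply/eqP; rewrite oppr_eq0; apply/eqP.
  elim/big_ind: _ => [|u v Hu Hv|i _]; first exact: sympl0r.
    by rewrite symplDr Hu Hv addr0.
  rewrite symplZr sympl_antisym; have := fy0 i; rewrite !mxE => ->.
  by rewrite oppr0 mulr0.
have := limg_ker_dim f fullv; rewrite capfv dim_full_space.
have : (\dim (limg f) <= \dim C)%N.
  by rewrite (leq_trans (dimvS (subvf _))) // dimvf /dim /= mul1n.
by have := dimvS kerC; dim_lia.
Qed.

Lemma sdual_fullv : sdual (fullv : {vspace V}) = 0%VS.
Proof.
apply/eqP; rewrite -subv0; apply/subvP => y /sdualP y0.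
by rewrite memv0; apply/eqP/sympl_nondegenerate => x; apply: y0; rewrite memvf.
Qed.

Lemma sdual_add C D : sdual (C + D)%VS = (sdual C :&: sdual D)%VS.
Proof.
apply/vspaceP => y; rewrite memv_cap.
apply/sdualP/andP => [CDy|[/sdualP Cy /sdualP Dy] x /memv_addP[u uC [v vD ->]]].
  split; apply/sdualP => x xC; apply: CDy.
    by rewrite (subvP (addvSl _ _)).
  by rewrite (subvP (addvSr _ _)).
rewrite sympl_antisym symplDr sympl_antisym Cy // sympl_antisym Dy //.
by rewrite !oppr0 addr0 oppr0.
Qed.

(** The lower bound suffices: the duals of [C] and of a complement of [C]
    meet trivially by nondegeneracy, so neither can exceed its lower bound. *)
Lemma dim_sdual C : (\dim (sdual C) + \dim C)%N = (n + n)%N.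
Proof.
apply/eqP; rewrite eqn_leq dim_sdual_ge andbT.
have := dimv_sum_cap (sdual C) (sdual C^C).
rewrite -sdual_add addv_complf sdual_fullv dimv0 addn0 => dsum.
have := dim_le_full (sdual C + sdual C^C)%VS.
rewrite {}dsum; have := dim_sdual_ge C^C; have := dimv_compl C.
by have := dim_full_space; have := dim_le_full C; dim_lia.
Qed.

Lemma sdual_sdual C : sdual (sdual C) = C.
Proof.
apply/esym/eqP; rewrite eqEdim; apply/andP; split.
  apply/subvP => x xC; apply/sdualP => y /sdualP yC.
  by rewrite sympl_antisym yC // oppr0.
by have := dim_sdual C; have := dim_sdual (sdual C); dim_lia.
Qed.

Lemma sdual_inj : injective (@sdual F n).
Proof. exact: can_inj sdual_sdual. Qed.

Lemma sdual_cap C D : sdual (C :&: D)%VS = (sdual C + sdual D)%VS.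
Proof. by apply: sdual_inj; rewrite sdual_add !sdual_sdual. Qed.

Lemma sdualS C D : (sdual D <= sdual C)%VS = (C <= D)%VS.
Proof.
apply/idP/idP => [/addv_idPr|/capv_idPl <-]; last by rewrite sdual_cap addvSr.
by rewrite -sdual_cap => /sdual_inj eqC; apply/capv_idPr.
Qed.

Lemma shull_sdual C : shull (sdual C) = shull C.
Proof. by rewrite /shull sdual_sdual capvC. Qed.

Lemma sdual_shull C : sdual (shull C) = (C + sdual C)%VS.
Proof. by rewrite sdual_cap sdual_sdual addvC. Qed.

Lemma dim_addv_line E v : v \notin E -> \dim (E + <[v]>)%VS = (\dim E).+1.
Proof.
move=> vE; have v0 : v != 0 by apply: contraNneq vE => ->; rewrite mem0v.
rewrite dimv_disjoint_sum ?dim_vline ?v0 ?addn1 //.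
apply/eqP; rewrite -subv0; apply/subvP => x.
rewrite memv_cap => /andP[xE /vlineP[c xc]].
rewrite memv0 xc; case: (eqVneq c 0) => [->|c0]; first by rewrite scale0r.
by case/negP: vE; rewrite -(scalerK c0 v) -xc memvZ.
Qed.

Lemma mem_addv_line E v x :
  reflect (exists2 e, e \in E & exists c, x = e + c *: v) (x \in E + <[v]>)%VS.
Proof.
apply: (iffP memv_addP) => [[e eE [w /vlineP[c ->] ->]]|[e eE [c ->]]].
  by exists e => //; exists c.
by exists e => //; exists (c *: v) => //; rewrite memvZ ?memv_line.
Qed.

Lemma addv_line_shift E v w : w - v \in E -> (E + <[w]>)%VS = (E + <[v]>)%VS.
Proof.
have sub a b : a - b \in E -> (E + <[a]> <= E + <[b]>)%VS.
  move=> abE; rewrite subv_add addvSl -memvE.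
  by apply/mem_addv_line; exists (a - b) => //; exists 1; rewrite scale1r subrK.
by move=> wvE; apply/eqP; rewrite eqEsubv !sub // -opprB memvN.
Qed.

(** By [sdual_shull], [v] is the sum of an element of [E] and an element [w]
    orthogonal to [E]; replacing [v] by [w] does not change [E + <[v]>], and
    the alternating form makes [w] an additional hull vector. *)
Lemma dim_shull_up E v : v \notin E -> v \in sdual (shull E) ->
  \dim (shull (E + <[v]>)) = (\dim (shull E)).+1.
Proof.
rewrite sdual_shull => + /memv_addP[e eE [w wE vew]].
have -> : (E + <[v]>)%VS = (E + <[w]>)%VS.
  by apply: addv_line_shift; rewrite vew addrK.
have -> : (v \in E) = (w \in E) by rewrite vew rpredDl.
move=> wNE; rewrite -(@dim_addv_line _ w); last first.
  by apply: contra wNE; rewrite memv_cap => /andP[].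
congr (\dim _); apply/vspaceP => x; apply/idP/idP.
  rewrite memv_cap => /andP[/mem_addv_line[f fE [c ->]]].
  rewrite sdual_add memv_cap => /andP[xE _].
  apply/mem_addv_line; exists f; last by exists c.
  by rewrite memv_cap fE /=; rewrite rpredDr ?memvZ in xE.
case/mem_addv_line => f; rewrite memv_cap => /andP[fE fdE] [c ->].
rewrite memv_cap sdual_add memv_cap; apply/and3P; split.
- by apply/mem_addv_line; exists f => //; exists c.
- by rewrite memvD // memvZ.
- apply/sdualP => _ /vlineP[d ->].
  rewrite symplDr symplZr ![sympl (_ *: w) _]sympl_antisym.
  rewrite !symplZr sympl_alternating.
  by move/sdualP: wE => -> //; rewrite !mulr0 !oppr0 mulr0 addr0.
Qed.

(** Pairing with a hull vector that is not orthogonal to [v] shows that the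
    new hull lies in [E]; it is then the hyperplane of [shull E] orthogonal to
    [v]. *)
Lemma dim_shull_down E v : v \notin sdual (shull E) ->
  (\dim (shull (E + <[v]>))).+1 = \dim (shull E).
Proof.
move=> vH; have [u uH uv] : exists2 u, u \in shull E & sympl u v != 0.
  apply/exists_inP; apply: contraNT vH => /exists_inPn h0.
  by apply/sdualP => u /h0; rewrite negbK => /eqP.
have -> : shull (E + <[v]>) = (shull E :&: sdual <[v]>)%VS.
  apply/vspaceP => x; rewrite /shull sdual_add !memv_cap -!andbA.
  apply/and3P/and3P => -[].
    case/mem_addv_line => e eE [c ->] xE xv; split=> //.
    suff -> : c = 0 by rewrite scale0r addr0.
    have := uH; rewrite memv_cap => /andP[uE /sdualP udE].
    have/sdualP/(_ _ uE) := xE; rewrite symplDr symplZr.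
    rewrite [sympl u e]sympl_antisym udE // oppr0 add0r => /eqP.
    by rewrite mulf_eq0 (negPf uv) orbF => /eqP.
  by move=> xE -> ->; split=> //; rewrite (subvP (addvSl _ _)).
apply/eqP; rewrite eqn_leq; apply/andP; split.
  rewrite ltn_neqAle dimvS ?capvSl // andbT.
  rewrite (dimv_leqif_eq (capvSl _ _)).
  apply/eqP => /capv_idPl/subvP/(_ _ uH)/sdualP/(_ v (memv_line v)).
  by rewrite sympl_antisym => /eqP; rewrite oppr_eq0 (negPf uv).
have := dimv_sum_cap (shull E) (sdual <[v]>).
have := dim_sdual <[v]>; rewrite dim_vline.
have := dim_le_full (shull E + sdual <[v]>)%VS.
by case: (v != 0); dim_lia.
Qed.
End SymplecticDuality.

(** * Counting one-step extensions by hull dimension *)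

Section Counting.
Variables (F : finFieldType) (n : nat).
Local Notation V := 'rV[F]_(n + n).
Local Notation q := #|F|.
Implicit Types (x y v : V) (C D E : {vspace V}).

Lemma card_vspaceD E C : (E <= C)%VS ->
  #|[pred v | (v \in C) && (v \notin E)]| = (q ^ \dim C - q ^ \dim E)%N.
Proof.
move=> EC; rewrite -!card_vspace -(cardID (mem E) (mem C)).
have -> : #|[predI mem C & mem E]| = #|E|.
  by apply: eq_card => v; rewrite !inE andb_idl // => /(subvP EC).
by rewrite addKn; apply: eq_card => v; rewrite !inE andbC.
Qed.

Definition covers E C := (E <= C)%VS && (\dim C == (\dim E).+1).

Lemma covers_addv_line E v : v \notin E -> covers E (E + <[v]>)%VS.
Proof. by move=> vE; rewrite /covers addvSl dim_addv_line ?eqxx. Qed.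

Lemma addv_line_eq E C v : covers E C ->
  (v \notin E) && ((E + <[v]>)%VS == C) = (v \in C) && (v \notin E).
Proof.
case/andP=> EC /eqP dC; apply/andP/andP => -[].
  by move=> -> /eqP <-; rewrite (subvP (addvSr _ _)) ?memv_line.
move=> vC vE; split=> //.
by rewrite eqEdim subv_add EC -memvE vC dC dim_addv_line /=.
Qed.

Lemma covers_sdual C D : covers (sdual D) C = covers (sdual C) D.
Proof.
rewrite /covers -[in LHS]sdualS sdual_sdual; congr andb.
by move: (dim_sdual C) (dim_sdual D) => dC dD; apply/eqP/eqP; dim_lia.
Qed.

Definition num_covers E (m : nat) :=
  #|[pred C | covers E C & \dim (shull C) == m]|.

(** Sort the vectors [v] outside [E] by the subspace [E + <[v]>]: each cover
    [C] of [E] arises from the vectors in [C] but not in [E]. *)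
Lemma num_coversM E m :
  (num_covers E m * (q ^ (\dim E).+1 - q ^ \dim E))%N =
  #|[pred v | v \notin E & \dim (shull (E + <[v]>)) == m]|.
Proof.
rewrite -[RHS]sum1_card (partition_big (fun v => E + <[v]>)%VS
   [pred C | covers E C & \dim (shull C) == m]) /=; last first.
  by move=> v /andP[vE ->]; rewrite covers_addv_line.
rewrite -sum_nat_const; apply: eq_bigr => C /andP[EC dC].
rewrite sum1_card; have /andP[sEC /eqP dimC] := EC.
rewrite -dimC -card_vspaceD //; apply: eq_card => v; rewrite !inE.
rewrite [RHS]/in_mem /= -(addv_line_eq v EC).
case: eqP => [eqC|_]; last by rewrite !andbF.
by rewrite inE eqC dC !andbT.
Qed.

Lemma num_covers_up E :
  (num_covers E (\dim (shull E)).+1 * (q ^ (\dim E).+1 - q ^ \dim E))%N =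
  (q ^ (n + n - \dim (shull E)) - q ^ \dim E)%N.
Proof.
rewrite num_coversM; have := dim_sdual (shull E) => dH.
have -> : (n + n - \dim (shull E))%N = \dim (sdual (shull E)) by dim_lia.
rewrite -card_vspaceD ?sdual_shull ?addvSl // -sdual_shull.
apply: eq_card => v; rewrite !inE andbC.
case: (boolP (v \in E)); rewrite ?andbF //= => vE.
rewrite !andbT; case: (boolP (v \in _)) => vH.
  by rewrite dim_shull_up ?eqxx.
by have := dim_shull_down vH; case: eqP; dim_lia.
Qed.

Lemma num_covers_down E m : \dim (shull E) = m.+1 ->
  (num_covers E m * (q ^ (\dim E).+1 - q ^ \dim E))%N =
  (q ^ (n + n) - q ^ (n + n - m.+1))%N.
Proof.
move=> dE; rewrite num_coversM; have := dim_sdual (shull E) => dH.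
have -> : (n + n - m.+1)%N = \dim (sdual (shull E)) by dim_lia.
rewrite -[in (q ^ (n + n))%N](dim_full_space F n) -card_vspaceD ?subvf //.
apply: eq_card => v; rewrite !inE memvf /=.
have [vH|vH] := boolP (v \in sdual _); last first.
  have := dim_shull_down vH; rewrite dE => -[->]; rewrite eqxx andbT.
  by apply: contra vH; apply/subvP; rewrite sdual_shull addvSl.
by apply/negP => /andP[vE]; rewrite dim_shull_up // dE; dim_lia.
Qed.

Definition num_flags (k h m : nat) :=
  (\sum_(E : {vspace V} | (\dim E == k) && (\dim (shull E) == h))
     num_covers E m)%N.

(** Duality reverses flags and preserves hulls, so hyperplanes of [C] are
    counted as covers of its dual. *)
Lemma num_flags_sdual k h m : (k < n + n)%N ->
  num_flags k h m = num_flags (n + n - k.+1) m h.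
Proof.
move=> lt_k.
rewrite /num_flags; under eq_bigr do rewrite /num_covers -sum1_card.
rewrite (exchange_big_dep
  [pred C | (\dim C == k.+1) && (\dim (shull C) == m)]) /=; last first.
  by move=> E C /andP[/eqP dE _] /andP[/andP[_ /eqP ->] ->]; rewrite dE eqxx.
rewrite [RHS](reindex_inj (@sdual_inj F n)) /=; apply: eq_big => [C|C].
  rewrite shull_sdual; congr (_ && _).
  by move: (dim_sdual C) => dC; apply/eqP/eqP; dim_lia.
move=> /andP[/eqP dC /eqP hC].
rewrite /num_covers -sum1_card [RHS](reindex_inj (@sdual_inj F n)) /=.
apply: eq_bigl => E; rewrite !inE shull_sdual hC eqxx andbT.
rewrite -covers_sdual sdual_sdual andbC.
have [/andP[_ /eqP]|//] := boolP (covers E C).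
by rewrite dC => -[->]; rewrite eqxx.
Qed.

Lemma num_flags_up k h :
  (num_flags k h h.+1 * (q ^ k.+1 - q ^ k))%N =
  (AS F n k h * (q ^ (n + n - h) - q ^ k))%N.
Proof.
rewrite /num_flags big_distrl /= /AS -sum_nat_const.
apply: eq_bigr => E /andP[/eqP <- /eqP <-].
exact: num_covers_up.
Qed.

Lemma num_flags_down k h :
  (num_flags k h.+1 h * (q ^ k.+1 - q ^ k))%N =
  (AS F n k h.+1 * (q ^ (n + n) - q ^ (n + n - h.+1)))%N.
Proof.
rewrite /num_flags big_distrl /= /AS -sum_nat_const.
apply: eq_bigr => E /andP[/eqP <- /eqP dE].
exact: num_covers_down.
Qed.

Lemma AS_sdual k h : (k <= n + n)%N -> AS F n (n + n - k) h = AS F n k h.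
Proof.
move=> le_k; rewrite /AS -!sum1_card (reindex_inj (@sdual_inj F n)) /=.
apply: eq_bigl => C; rewrite !inE shull_sdual; congr (_ && _).
by move: (dim_sdual C) => dC; apply/eqP/eqP; dim_lia.
Qed.

End Counting.

(** * Recurrences for the number of subspaces *)

(** The algebra shared by the two recurrences: [N] is the number of flags,
    counted from the smaller subspace in one hypothesis and from the larger
    one in the other.  Here [x] is [q], and [u], [v], [w] are powers of [q]. *)
Lemma flag_count_cancel (K : fieldType) (x u v w N A B : K) :
  x - 1 != 0 -> u != 0 -> v != 0 -> w != 0 ->
  N * (x * (u * w) - u * w) = A * (u * w * (x * v) - u * w) ->
  N * (x * (v * w) - v * w) = B * (u * v * w * (x * w) - u * v * w) ->
  A * (x * v - 1) = B * (u * (x * w - 1)).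
Proof.
move=> x1 u0 v0 w0 e1 e2.
have nz : u * v * w * w * (x - 1) != 0 by rewrite !mulf_neq0.
apply: (mulIf nz).
transitivity (N * (x * (u * w) - u * w) * (v * w * (x - 1))).
  by rewrite e1; ring.
transitivity (N * (x * (v * w) - v * w) * (u * w * (x - 1))).
  by ring.
by rewrite e2; ring.
Qed.

Section Recurrences.
Variables (R : numFieldType) (F : finFieldType) (n : nat).
Local Notation q := (#|F|%:R : R).

Lemma q_gt1 : 1 < q.
Proof. by rewrite ltr1n finNzRing_gt1. Qed.

Lemma qX_neq0 i : q ^+ i != 0.
Proof. by rewrite expf_neq0 // gt_eqF // (lt_trans ltr01 q_gt1). Qed.

Lemma qX_gt1 i : (0 < i)%N -> 1 < q ^+ i.
Proof. by move=> i0; rewrite exprn_egt1 ?q_gt1 // -lt0n. Qed.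

Lemma qX_neq1 i : (0 < i)%N -> q ^+ i - 1 != 0.
Proof. by move=> i0; rewrite subr_eq0 gt_eqF ?qX_gt1. Qed.

Lemma natrBX i j : (j <= i)%N -> (#|F| ^ i - #|F| ^ j)%:R = q ^+ i - q ^+ j.
Proof.
by move=> ji; rewrite natrB ?natrX // leq_pexp2l // ltnW // finNzRing_gt1.
Qed.

(** Flags along which the hull grows; the parameters are [c = k - h] and
    [d + 1 = 2n - k - h] for the smaller dimension [k = c + h], which makes
    all exponents free of subtraction. *)
Lemma AS_up c d h : (n + n = c + d.+1 + h.*2)%N ->
  (AS F n (c + h) h)%:R * (q ^+ d.+1 - 1) =
  (AS F n (c + h).+1 h.+1)%:R * (q ^+ c * (q ^+ h.+1 - 1)).
Proof.
move=> n2; have ltk : (c + h < n + n)%N by lia.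
have /(congr1 (fun m => m%:R : R)) := num_flags_up F n (c + h) h.
have /(congr1 (fun m => m%:R : R)) := num_flags_down F n (n + n - (c + h).+1) h.
rewrite -num_flags_sdual // AS_sdual // !natrM !natrBX; try lia.
have -> : ((n + n - (c + h).+1).+1 = (d + h).+1)%N by lia.
have -> : (n + n - (c + h).+1 = d + h)%N by lia.
have -> : (n + n - h.+1 = c + d + h)%N by lia.
have -> : (n + n - h = c + h + d.+1)%N by lia.
have -> : (n + n = c + d + h + h.+1)%N by lia.
have q1 : q - 1 != 0 by rewrite -[q]expr1 qX_neq1.
rewrite !(exprS, exprD) => e1 e2.
exact: (flag_count_cancel q1 (qX_neq0 c) (qX_neq0 d) (qX_neq0 h)
          e2 e1).
Qed.

(** The companion of [AS_up] for flags along which the hull shrinks; now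
    [d = 2n - (k + 1) - h], again with [k = c + h]. *)
Lemma AS_down c d h : (n + n = c.+1 + d + h.*2)%N ->
  (AS F n (c + h).+1 h)%:R * (q ^+ c.+1 - 1) =
  (AS F n (c + h) h.+1)%:R * (q ^+ d * (q ^+ h.+1 - 1)).
Proof.
move=> n2; have ltk : (c + h < n + n)%N by lia.
have /(congr1 (fun m => m%:R : R)) := num_flags_down F n (c + h) h.
have /(congr1 (fun m => m%:R : R)) := num_flags_up F n (n + n - (c + h).+1) h.
rewrite -num_flags_sdual // AS_sdual // !natrM !natrBX; try lia.
have -> : ((n + n - (c + h).+1).+1 = (d + h).+1)%N by lia.
have -> : (n + n - (c + h).+1 = d + h)%N by lia.
have -> : (n + n - h.+1 = d + c + h)%N by lia.
have -> : (n + n - h = d + h + c.+1)%N by lia.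
have -> : (n + n = d + c + h + h.+1)%N by lia.
have q1 : q - 1 != 0 by rewrite -[q]expr1 qX_neq1.
rewrite !(exprS, exprD) => e1 e2.
exact: (flag_count_cancel q1 (qX_neq0 d) (qX_neq0 c) (qX_neq0 h)
          e1 e2).
Qed.

End Recurrences.

Section HullRatio.
Variables (F : finFieldType) (n : nat).

(** Totally isotropic subspaces exist in every dimension up to [n]: [AS_up]
    extends the zero subspace one dimension at a time. *)
Lemma AS_isotropic_gt0 m : (m <= n)%N -> (0 < AS F n m m)%N.
Proof.
elim: m => [_|m IHm lt_mn].
  by apply/card_gt0P; exists 0%VS; rewrite inE /shull cap0v dimv0 !eqxx.
have /(@AS_up rat F n) :
  (n + n = 0 + (n + n - m.*2).-1.+1 + m.*2)%N by lia.
rewrite !add0n lt0n => e; apply/eqP => m0; move: e; rewrite m0 mul0r; apply/eqP.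
by rewrite mulf_neq0 ?qX_neq1 // pnatr_eq0 -lt0n IHm // ltnW.
Qed.

(** [AS_down] trades one hull dimension for one dimension of the subspace, so
    [a / 2] steps lead here from an isotropic subspace of dimension
    [l + a / 2]; this is where the parity of [a] enters. *)
Lemma AS_gt0 a l : ~~ odd a -> (a + l.*2 <= n + n)%N ->
  (0 < AS F n (a + l) l)%N.
Proof.
move=> /even_halfK <-; elim: a./2 l => [|r IHr] l.
  by rewrite add0n => ?; apply: AS_isotropic_gt0; lia.
move=> le_n; have /(@AS_down rat F n) :
  (n + n = r.*2.+1.+1 + (n + n - r.+1.*2 - l.*2) + l.*2)%N by lia.
rewrite doubleS !addSn lt0n => e; apply/eqP => m0.
move: e; rewrite m0 mul0r => /esym; apply/eqP.
rewrite mulf_neq0 ?mulf_neq0 ?qX_neq0 ?qX_neq1 //.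
rewrite pnatr_eq0 -lt0n -addnS.
by apply: IHr; lia.
Qed.

(** Both sides count through subspaces of dimension [a + l - 1] with hull of
    dimension [l + 1]: go up by [AS_down] on the left, by [AS_up] on the
    right. *)
Lemma AS_hull_step (R : numFieldType) a b l : (2 <= a)%N -> (1 <= b)%N ->
  (n + n = a + b + l.*2)%N ->
  (AS F n (a + l) l)%:R * ((#|F|%:R ^+ a - 1) * (#|F|%:R ^+ b - 1)) =
  (AS F n (a + l) l.+2)%:R * (#|F|%:R ^+ (a + b - 2) *
     ((#|F|%:R ^+ l.+1 - 1) * (#|F|%:R ^+ l.+2 - 1))) :> R.
Proof.
case: a b => [|[|a]] [|b] // _ _ n2.
have n2' : (n + n = a + b.+1 + l.+1.*2)%N by lia.
have := AS_up R F n2'; rewrite -[(a + l.+1)%N]addSnnS => up.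
rewrite mulrA (@AS_down R F n a.+1 b.+1 l n2) mulrAC up.
by have -> : (a.+2 + b.+1 - 2 = a + b.+1)%N; [lia | rewrite exprD !addSn; ring].
Qed.
End HullRatio.

(** * Ratios and their limits *)

Lemma double_n_of l a b : ~~ odd a -> ~~ odd b ->
  (n_of l a b + n_of l a b = a + b + l.*2)%N.
Proof. by rewrite /n_of; lia. Qed.

Section Ratios.
Variables (R : realType) (F : finFieldType).
Local Notation q := (#|F|%:R : R).

Definition limit_ratio l : R := (q ^+ l.+1 - 1) * (q ^+ l.+2 - 1) / q ^+ 2.

(** This is [q^a / (q^a - 1)] for [a > 0] ([correctionE]), in the form that
    makes the limit visible. *)
Definition correction a : R := (1 - q^-1 ^+ a)^-1.

Lemma q_neq0 : q != 0.
Proof. by rewrite -[q]expr1 qX_neq0. Qed.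

Lemma correctionE a : (0 < a)%N -> correction a = q ^+ a / (q ^+ a - 1).
Proof.
move=> a0; rewrite /correction exprVn.
move: (qX_neq0 R F a) (qX_neq1 R F a0) => n0 n1.
by field; rewrite n0 n1.
Qed.

Lemma ratioS_abE l a b : (2 <= a)%N -> (2 <= b)%N -> ~~ odd a -> ~~ odd b ->
  ratioS_ab R F l a b = limit_ratio l * correction a * correction b.
Proof.
move=> a2 b2 ao bo; have n2 := double_n_of l ao bo.
have := AS_hull_step F R a2 (ltnW b2) n2.
rewrite /ratioS_ab /ratioS /k_of.
set A := AS _ _ _ l; set B := AS _ _ _ l.+2 => e.
have B0 : B%:R != 0 :> R.
  rewrite pnatr_eq0 -lt0n /B.
  have -> : (a + l = (a - 2) + l.+2)%N by lia.
  by apply: AS_gt0; lia.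
rewrite !correctionE; try lia.
have qa := @qX_neq1 R F a; have qb := @qX_neq1 R F b.
apply: (mulIf B0); rewrite divfK //.
apply: (@mulIf _ ((q ^+ a - 1) * (q ^+ b - 1))).
  by rewrite mulf_neq0 ?qa ?qb; lia.
rewrite e /limit_ratio.
have -> : q ^+ (a + b - 2) = q ^+ a * q ^+ b / q ^+ 2.
  by rewrite -exprD -{2}(@subnK 2 (a + b)) ?exprD ?mulfK ?qX_neq0 //; lia.
by field; rewrite q_neq0 qa ?qb //; lia.
Qed.

Lemma even_oo_ge N : \forall m \near even_oo, (N <= m)%N /\ ~~ odd m.
Proof.
rewrite near_withinE; near=> m => mo; split=> //.
by near: m; exact: nbhs_infty_ge.
Unshelve. all: by end_near. Qed.

Lemma near_joint (P : set nat) : (\forall a \near even_oo, P a) ->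
  \forall p \near joint, P p.1 /\ P p.2.
Proof. by move=> Pe; exists (P, P). Qed.

Lemma cvg_correction : correction @ even_oo --> (1 : R).
Proof.
have c0 : (fun a => q^-1 ^+ a) @ \oo --> (0 : R).
  apply: cvg_expr; rewrite ger0_norm ?invr_ge0 // invf_lt1 ?q_gt1 //.
  exact: lt_trans ltr01 (q_gt1 R F).
have c1 : (fun a => 1 - q^-1 ^+ a) @ \oo --> (1 - 0 : R).
  exact: cvgB (cvg_cst _) c0.
have n0 : 1 - 0 != 0 :> R by rewrite subr0 oner_neq0.
have := cvgV n0 c1; rewrite subr0 invr1 => c2.
by apply: cvg_within_filter; exact: c2.
Qed.

Lemma cvg_ratioS_boundary l a : (2 <= a)%N -> ~~ odd a ->
  ratioS_ab R F l a @ even_oo --> limit_ratio l * correction a.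
Proof.
move=> a2 ao.
have c : (fun b => limit_ratio l * correction a * correction b) @ even_oo
    --> limit_ratio l * correction a * 1.
  exact: cvgM (cvg_cst _) cvg_correction.
rewrite mulr1 in c; apply: cvg_trans c; apply: near_eq_cvg; near=> b.
have [b2 bo] : (2 <= b)%N /\ ~~ odd b by near: b; exact: even_oo_ge.
by rewrite /= ratioS_abE.
Unshelve. all: by end_near. Qed.

Lemma cvg_ratioS_joint l :
  (fun p : nat * nat => ratioS_ab R F l p.1 p.2) @ joint --> limit_ratio l.
Proof.
have c1 : (fun p : nat * nat => correction p.1) @ joint --> (1 : R).
  exact: cvg_comp cvg_fst cvg_correction.
have c2 : (fun p : nat * nat => correction p.2) @ joint --> (1 : R).
  exact: cvg_comp cvg_snd cvg_correction.
have c : (fun p : nat * nat =>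
    limit_ratio l * correction p.1 * correction p.2) @ joint
    --> limit_ratio l * 1 * 1.
  exact: cvgM (cvgM (cvg_cst _) c1) c2.
rewrite !mulr1 in c; apply: cvg_trans c; apply: near_eq_cvg; near=> p.
have [[a2 ao] [b2 bo]] :
    ((2 <= p.1)%N /\ ~~ odd p.1) /\ ((2 <= p.2)%N /\ ~~ odd p.2).
  by near: p; exact: (near_joint (even_oo_ge 2)).
by rewrite /= ratioS_abE.
Unshelve. all: by end_near. Qed.

Lemma joint_ratioE l : joint_ratio R F l = limit_ratio l.
Proof.
apply: cvg_lim; first exact: norm_hausdorff.
exact: cvg_ratioS_joint.
Qed.

Lemma limit_ratio_lt l m : (l < m)%N -> limit_ratio l < limit_ratio m.
Proof.
move=> lm.
rewrite ltr_pM2r ?invr_gt0 ?exprn_gt0 ?(lt_trans ltr01 (q_gt1 R F)) //.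
have pos i : 0 < q ^+ i.+1 - 1 by rewrite subr_gt0 qX_gt1.
by rewrite ltr_pM ?(ltW (pos _)) // ltrD2r ltr_eXn2l ?q_gt1.
Qed.

End Ratios.

Section FiniteComparisons.
Variables (F : finFieldType) (n : nat).
Local Notation q := (#|F|%:R : rat).

(** With [a = k] and [b = 2n - k], [AS_hull_step] shows that the inequality would
    require [2^(a+b-2) > (2^a - 1) * (2^b - 1)], whereas [2^(i-1) <= 2^i - 1]. *)
Lemma BBO_fails k : #|F| = 2%N -> (2 <= k)%N -> (k < n + n)%N ->
  ~~ BBO F n k 0.
Proof.
move=> q2 k2 kn; rewrite /BBO -leqNgt -(ler_nat rat).
have := @AS_hull_step F n rat k (n + n - k) 0 k2 _ _.
rewrite addn0 q2 => /(_ ltac:(lia) ltac:(lia)) e.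
have half i : (0 < i)%N -> 2 ^+ i.-1 <= 2 ^+ i - 1 :> rat.
  case: i => // i _; rewrite exprS /=.
  by have := exprn_ege1 i (ler1n rat 2); lra.
have pos : 0 < 2 ^+ (k + (n + n - k) - 2) :> rat by rewrite exprn_gt0.
rewrite -[((2 ^ 1 - 1) * (2 ^ 2 - 1))%N]/3%N natrM -(ler_pM2r pos).
apply: le_trans (_ : _ <=
  (AS F n k 0)%:R * ((2 ^+ k - 1) * (2 ^+ (n + n - k) - 1))) _.
  rewrite ler_wpM2l //.
  have -> : (k + (n + n - k) - 2 = k.-1 + (n + n - k).-1)%N by lia.
  by rewrite exprD ler_pM ?exprn_ge0 ?half //; lia.
by rewrite e le_eqVlt; apply/orP; left; apply/eqP; ring.
Qed.

(** For [l >= 1] the factor [(q^l.+1 - 1) * (q^l.+2 - 1)] is at least [q^2],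
    because [q^2 - 1 >= q]; the right side of [AS_hull_step] is then at least
    [AS k l.+2 * q^(a+b)], while the left side is below [AS k l * q^(a+b)]. *)
Lemma hull_mono_of_ge1 a b l :
  (1 <= l)%N -> (2 <= a)%N -> (2 <= b)%N -> ~~ odd a ->
  (n + n = a + b + l.*2)%N -> hull_mono F n (a + l) l.
Proof.
move=> l1 a2 b2 ao n2; rewrite /hull_mono -(ltr_nat rat).
have e := AS_hull_step F rat a2 (ltnW b2) n2.
have pos i : 0 < q ^+ i by rewrite exprn_gt0 // (lt_trans ltr01 (q_gt1 _ _)).
have gtq i : (2 <= i)%N -> q <= q ^+ i - 1.
  move=> i2; apply: le_trans (_ : q ^+ 2 - 1 <= _); last first.
    by rewrite lerD2r ler_eXn2l ?q_gt1.
  by have : 2 <= q; [rewrite ler_nat finNzRing_gt1 | nra].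
rewrite -(ltr_pM2r (pos (a + b))).
apply: le_lt_trans (_ :
  (AS F n (a + l) l)%:R * ((q ^+ a - 1) * (q ^+ b - 1)) < _).
  rewrite e ler_wpM2l //; have -> : q ^+ (a + b) = q ^+ (a + b - 2) * (q * q).
    by rewrite -expr2 -exprD subnK //; lia.
  rewrite ler_wpM2l ?(ltW (pos _)) //.
  by rewrite ler_pM ?gtq.
rewrite ltr_pM2l; last by rewrite ltr0n AS_gt0 //; lia.
rewrite exprD.
by move: (qX_gt1 rat F (ltnW a2)) (qX_gt1 rat F (ltnW b2)); nra.
Qed.
End FiniteComparisons.

(** * The corollary *)

Theorem corollary16 (R : realType) (q : nat) (F : finFieldType)
    (card_F : #|F| = q) :
  (* (1) *)
  (forall l a : nat, (2 <= a)%N -> ~~ odd a ->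
     (fun b : nat => ratioS_ab R F l a b) @ even_oo -->
       (q%:R ^+ (a - 2) * (q%:R ^+ l.+1 - 1) * (q%:R ^+ l.+2 - 1)
         / (q%:R ^+ a - 1) : R))
  /\
  (* (2) *)
  (forall l : nat,
     (fun p : nat * nat => ratioS_ab R F l p.1 p.2) @ joint -->
       ((q%:R ^+ l.+1 - 1) * (q%:R ^+ l.+2 - 1) / q%:R ^+ 2 : R))
  /\
  (* (3) *)
  [/\ (forall l : nat, joint_ratio R F 0 <= joint_ratio R F l)
      /\ joint_ratio R F 0 = (q%:R - 1) * (q%:R ^+ 2 - 1) / q%:R ^+ 2,
      q = 2%N ->
        [/\ joint_ratio R F 0 = 3 / 4,
            (3 / 4 : R) < 1,
            \forall p \near joint,
              exc_S (2 * n_of 0 p.1 p.2, k_of 0 p.1, 0, q)%N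
          & joint_ratio R F 1 = 21 / 4],
      (forall N : nat, exists n k : nat,
         [/\ exc_S (2 * n, k, 0, 2)%N, (N <= k)%N & (N <= 2 * n - k)%N])
      /\ (forall n k l : nat, exc_S (2 * n, k, l, q)%N -> ~~ BBO F n k l),
      (3 <= q)%N ->
        [/\ joint_ratio R F 0 = (q%:R - 1) ^+ 2 * (q%:R + 1) / q%:R ^+ 2,
            16 / 9 <= joint_ratio R F 0,
            (16 / 9 : R) > 1
          & forall n k : nat, ~ exc_S (2 * n, k, 0, q)%N]
    & forall l : nat, (1 <= l)%N ->
        [/\ joint_ratio R F 0 < joint_ratio R F l,
            \forall p \near joint, hull_mono F (n_of l p.1 p.2) (k_of l p.1) l
          & forall a : nat, (2 <= a)%N -> ~~ odd a ->
              \forall b \near even_oo, hull_mono F (n_of l a b) (k_of l a) l]].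
Proof.
have limE l : joint_ratio R F l =
    (q%:R ^+ l.+1 - 1) * (q%:R ^+ l.+2 - 1) / q%:R ^+ 2.
  by rewrite joint_ratioE /limit_ratio card_F.
have q0 : q%:R != 0 :> R by rewrite -card_F q_neq0.
have mono l : (0 < l)%N -> joint_ratio R F 0 < joint_ratio R F l.
  by move=> l0; rewrite !joint_ratioE limit_ratio_lt.
split; [|split].
- move=> l a a2 ao; have := @cvg_ratioS_boundary R F l a a2 ao.
  have -> // : limit_ratio R F l * correction R F a =
      q%:R ^+ (a - 2) * (q%:R ^+ l.+1 - 1) * (q%:R ^+ l.+2 - 1)
        / (q%:R ^+ a - 1).
  rewrite correctionE ?(ltnW a2) // /limit_ratio card_F -{1}(subnK a2) exprD.
  have := @qX_neq1 R F a (ltnW a2); rewrite card_F => qa.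
  by field; rewrite q0 qa.
- move=> l; have := @cvg_ratioS_joint R F l.
  by rewrite /limit_ratio card_F.
split.
- split; last by rewrite limE expr1.
  by case=> [|l]; rewrite ?lexx // ltW // mono.
- move=> q2; split.
  + by rewrite limE q2; field.
  + by lra.
  + near=> p.
    have [[a4 ao] [b4 bo]] :
        ((4 <= p.1)%N /\ ~~ odd p.1) /\ ((4 <= p.2)%N /\ ~~ odd p.2).
      by near: p; exact: (near_joint (even_oo_ge 4)).
    exists (n_of 0 p.1 p.2), (k_of 0 p.1); rewrite q2; split=> //.
      by have := double_n_of 0 ao bo; rewrite /k_of; lia.
    by rewrite /k_of addn0.
  + by rewrite limE q2; field.
- split.
    move=> N; exists (N.*2 + 4)%N, (N.*2 + 4)%N.
    by split; [exists (N.*2 + 4)%N, (N.*2 + 4)%N; split=> //; lia| lia | lia].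
  move=> n k l [n' [k' [[n2 -> -> q2] k4 ko]]]; apply: BBO_fails; lia.
- move=> q3; have q3R : 3 <= q%:R :> R by rewrite ler_nat.
  split.
  + by rewrite limE; field.
  + rewrite limE ler_pdivlMr; last by rewrite exprn_gt0 //; lra.
    by rewrite expr1 !expr2; nra.
  + by lra.
  + by move=> n k [n' [k' [[_ _ q2] _ _]]]; move: q3; rewrite q2.
- move=> l l1.
  have hm a b : (2 <= a)%N /\ ~~ odd a -> (2 <= b)%N /\ ~~ odd b ->
      hull_mono F (n_of l a b) (k_of l a) l.
    by move=> [a2 ao] [b2 bo]; apply: hull_mono_of_ge1 (double_n_of l ao bo).
  split; first exact: mono.
  + near=> p.
    have [ha hb] :
        ((2 <= p.1)%N /\ ~~ odd p.1) /\ ((2 <= p.2)%N /\ ~~ odd p.2).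
      by near: p; exact: (near_joint (even_oo_ge 2)).
    exact: hm.
  + move=> a a2 ao; near=> b; apply: hm => //.
    by near: b; exact: even_oo_ge.
Unshelve. all: by end_near. Qed.
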